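(* Let $p>0$. Then each element of $\mathbb{L}^p_c$ has a quasi-continuous version.
   Context: $\Omega$ is a complete separable metric space with Borel $\sigma$-algebra $\mathscr{B}(\Omega)$, and $\mathscr{P}$ is a given nonempty set of probability measures on $(\Omega,\mathscr{B}(\Omega))$. $L^0(\Omega)$ is the space of real Borel functions on $\Omega$, and $C_b(\Omega)$ the bounded continuous ones. For $A\in\mathscr{B}(\Omega)$, $c(A):=\sup_{P\in\mathscr{P}}P(A)$. A Borel set $A$ is polar if $c(A)=0$, and a property holds quasi-surely (q.s.) if it holds outside a polar set. For $X\in L^0(\Omega)$ such that $E_P[X]$ exists for each $P\in\mathscr{P}$, $\mathbb{E}[X]:=\sup_{P\in\mathscr{P}}E_P[X]$. For $p>0$, $\mathcal{L}^p=\{X\in L^0(\Omega):\mathbb{E}[|X|^p]<\infty\}$, $\mathcal{N}=\{X\in L^0(\Omega):X=0\text{ q.s.}\}$, $\mathbb{L}^p=\mathcal{L}^p/\mathcal{N}$ (classes are not distinguished from representatives). $\mathbb{L}^p$ is a Banach space under $\|X\|_p=(\mathbb{E}[|X|^p])^{1/p}$ if $p\ge1$, and a complete metric space under $d(X,Y)=\mathbb{E}[|X-Y|^p]$ if $p<1$. $\mathbb{L}^p_c$ is the completion of $C_b(\Omega)$ with respect to this distance, i.e. the closure in $\mathbb{L}^p$ of (the image of) $C_b(\Omega)$. A map $X$ on $\Omega$ with values in a topological space is quasi-continuous if for every $\varepsilon>0$ there is an open set $O$ with $c(O)<\varepsilon$ such that $X|_{O^c}$ is continuous. $X:\Omega\to\mathbb{R}$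 has a quasi-continuous version if there is a quasi-continuous $Y:\Omega\to\mathbb{R}$ with $X=Y$ q.s. *)

(* Defs.v *)
From HB Require Import structures.
From mathcomp Require Import all_boot all_order all_algebra.
From mathcomp Require Import all_classical all_reals all_analysis.

Set Implicit Arguments.
Unset Strict Implicit.
Unset Printing Implicit Defensive.

Import Order.TTheory GRing.Theory Num.Theory.
Import numFieldNormedType.Exports.

Local Open Scope classical_set_scope.
Local Open Scope ring_scope.

(* [Complete] carries a distinguished point; a space that supports a
   probability measure is nonempty, so this costs no generality. *)
#[short(type="completeMetricType")]
HB.structure Definition CompleteMetric (R : numDomainType) :=
  {T of Complete T & Metric R T}.

Definition separable (T : topologicalType) : Prop :=
  exists2 D : set T, countable D & dense D.

Notation borel T := (g_sigma_algebraType (@open T)).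

Section quasi_sure.
Context {R : realType} {Omega : completeMetricType R}.
Variable PP : set (probability (borel Omega) R).

Local Open Scope ereal_scope.

Definition capacity (A : set Omega) : \bar R := ereal_sup [set P A | P in PP].

Definition polar (A : set Omega) : Prop :=
  measurable (A : set (borel Omega)) /\ capacity A = 0.

(* [Q] need not be a Borel property. *)
Definition quasi_surely (Q : Omega -> Prop) : Prop :=
  exists2 A, polar A & forall w, ~ A w -> Q w.

Definition upper_expectation (X : Omega -> R) : \bar R :=
  ereal_sup [set 'E_P[X] | P in PP].

Definition L0 : set (Omega -> R) :=
  [set X | measurable_fun [set: borel Omega] X].

Definition Cb : set (Omega -> R) :=
  [set f | continuous f /\ bounded_fun f].

Definition Lp (p : R) : set (Omega -> R) :=
  [set X | L0 X /\ upper_expectation (fun w => `|X w| `^ p)%R < +oo].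

Definition Lp_dist (p : R) (X Y : Omega -> R) : \bar R :=
  let E := upper_expectation (fun w => `|X w - Y w| `^ p)%R in
  if (1 <= p)%R then E `^ p^-1 else E.

(* Classes modulo quasi-sure equality are handled through representatives:
   [Lpc p] is the set of all Borel functions whose class lies in the closure of
   the image of [Cb] in the quotient of [Lp p]; this set is saturated, because
   [Lp_dist p] does not distinguish quasi-surely equal Borel functions. *)
Definition Lpc (p : R) : set (Omega -> R) :=
  [set X | Lp p X /\
    forall e : R, (0 < e)%R -> exists2 f, Cb f & Lp_dist p X f < e%:E].

Definition quasi_continuous (T : topologicalType) (X : Omega -> T) : Prop :=
  forall e : R, (0 < e)%R ->
    exists O : set Omega,
      [/\ open O, capacity O < e%:E & {within ~` O, continuous X}].

Definition has_qc_version (X : Omega -> R) : Prop :=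
  exists2 Y : Omega -> R,
    quasi_continuous Y & quasi_surely (fun w => X w = Y w).

End quasi_sure.

(* Main.v *)
Require Import Defs.
From HB Require Import structures.
From mathcomp Require Import all_boot all_order all_algebra.
From mathcomp Require Import all_classical all_reals all_analysis.
From mathcomp Require Import measurable_realfun lra.
Import Order.TTheory GRing.Theory Num.Theory.
Import numFieldNormedType.Exports.
Local Open Scope classical_set_scope.
Local Open Scope ring_scope.

(** Choose continuous [f n] with capacity of [|X - f n| >= 2^-(n+1)] at most
    [2^-(n+1)], by Markov's inequality under each [P].  Where
    [|f n.+1 - f n| <= 2^-n] for all [n >= k] the [f n] converge uniformly, so
    their limit is continuous there.  The exceptional set is open because the
    [f n] are continuous, and it is contained in the union of the sets
    [|X - f n| >= 2^-(n+1)], [n >= k], whose capacity is at most [2^-k].  The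
    same union shows that [X] is the limit of the [f n] quasi-surely. *)

Lemma exprVn2_lt_near (R : realType) (e : R) :
  0 < e -> \forall n \near \oo, 2^-1 ^+ n < e.
Proof.
move=> e0; have /cvgrPdist_lt/(_ e e0) : (2^-1 ^+ n : R) @[n --> \oo] --> 0.
  by apply: cvg_expr; rewrite ger0_norm ?invr_ge0// invf_lt1// ltr1n.
by apply: filterS => n; rewrite sub0r normrN ger0_norm ?exprn_ge0 ?invr_ge0.
Qed.

Lemma continuous_borel_measurable (R : realType) (T : ptopologicalType)
    (f : T -> R) :
  continuous f -> measurable_fun [set: borel T] (f : borel T -> R).
Proof.
move=> cf; apply: (measurability _ (RGenOInfty.measurableE R)).
move=> _ [_ [a ->]] <-; rewrite setTI; apply: sub_sigma_algebra.
by apply: open_comp => [w _|]; [exact: cf|exact: interval_open].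
Qed.

Lemma open_lt_dist (R : realType) (T : topologicalType) (f g : T -> R) (a : R) :
  continuous f -> continuous g -> open [set w | a < `|f w - g w|].
Proof.
move=> cf cg.
rewrite (_ : [set _ | _] = (fun w => `|f w - g w|) @^-1` `]a, +oo[); last first.
  by apply/seteqP; split=> w /=; rewrite in_itv /= andbT.
apply: open_comp => [w _|]; last exact: interval_open.
by apply: cvg_norm; apply: cvgB; [exact: cf|exact: cg].
Qed.

Lemma measurable_le_normr (R : realType) d (T : measurableType d)
    (h : T -> R) (e : R) :
  measurable_fun [set: T] h -> measurable [set w | e <= `|h w|].
Proof.
move=> mh; rewrite [X in measurable X](_ : _ =
    [set: T] `&` (fun w => `|h w|) @^-1` `[e, +oo[); last first.
  by apply/seteqP; split=> w /=; rewrite in_itv /= andbT => //; case.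
exact: (measurableT_comp (@normr_measurable R setT) mh).
Qed.

Lemma markov_powR (R : realType) d (T : measurableType d)
    (P : probability T R) (h : T -> R) (p e : R) :
  measurable_fun [set: T] h -> 0 <= p -> 0 < e ->
  ((e `^ p)%:E * P [set w | (e <= `|h w|)%R] <=
    'E_P[fun w => (`|h w| `^ p)%R])%E.
Proof.
move=> mh p0 e0.
pose H := HB.pack_for {mfun T >-> R} h (isMeasurableFun.Build _ _ _ _ h mh).
have /= := @markov _ _ _ P H (fun x => x `^ p) e e0 (measurable_powR _) _ _.
apply=> [r _|]; first exact: powR_ge0.
exact: ge0_ler_powR.
Qed.

Section capacity.
Context {R : realType} {Omega : completeMetricType R}.
Variable PP : set (probability (borel Omega) R).

Lemma capacity_le (A : set Omega) (x : \bar R) :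
  (forall P, PP P -> (P A <= x)%E) -> (capacity PP A <= x)%E.
Proof. by move=> PA; apply: ge_ereal_sup => _ [P PPP <-]; exact: PA. Qed.

Lemma le_probability_capacity (A : set Omega) P :
  PP P -> (P A <= capacity PP A)%E.
Proof. by move=> PPP; apply: ereal_sup_ubound; exists P. Qed.

Lemma le_capacity (A B : set Omega) :
  measurable (A : set (borel Omega)) -> measurable (B : set (borel Omega)) ->
  A `<=` B -> (capacity PP A <= capacity PP B)%E.
Proof.
move=> mA mB AB; apply: capacity_le => P PPP.
apply: le_trans (le_probability_capacity _ _ PPP).
by apply: le_measure; rewrite ?inE.
Qed.

(** Some member of [PP] is needed here, since the supremum of an empty family is [-oo]. *)
Lemma capacity_ge0 (A : set Omega) : PP !=set0 -> (0 <= capacity PP A)%E.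
Proof.
by case=> P PPP; apply: le_trans (le_probability_capacity A _ PPP).
Qed.

(** Countable subadditivity is applied under each [P] separately; the geometric series bounds the
    result by [e] uniformly in [P]. *)
Lemma capacity_bigcup_le (B : (set Omega)^nat) (e : R) :
  (forall n, measurable (B n : set (borel Omega))) -> 0 <= e ->
  (forall n, capacity PP (B n) <= (e / (2 ^ n.+1)%:R)%:E)%E ->
  (capacity PP (\bigcup_n B n) <= e%:E)%E.
Proof.
move=> mB e0 cB; apply: capacity_le => P PPP.
apply: (le_trans (@measure_sigma_subadditive _ _ _ P _ B mB _ _)) => //.
  exact: bigcup_measurable.
apply: le_trans (epsilon_trick0 xpredT e0).
apply: lee_nneseries => // n _.
exact: le_trans (le_probability_capacity _ _ PPP) (cB n).
Qed.

Lemma upper_expectation_lt_of_dist (p : R) (X Y : Omega -> R) (d : R) :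
  PP !=set0 -> 0 < p -> 0 < d ->
  (Lp_dist PP p X Y < (if 1 <= p then d `^ p^-1 else d)%:E)%E ->
  (upper_expectation PP (fun w => `|X w - Y w| `^ p)%R < d%:E)%E.
Proof.
move=> [P PPP] p0 d0; rewrite /Lp_dist; case: ifPn => // p1.
set E := upper_expectation _ _; rewrite !ltNge; apply: contra => dE.
have E0 : (0 <= E)%E by apply: le_trans dE; rewrite lee_fin ltW.
rewrite -poweR_EFin gt0_ler_poweR ?in_itv/= ?leey ?andbT ?lee_fin//.
- by rewrite invr_ge0 ltW.
- by rewrite ltW.
Qed.

Lemma Lpc_approx_in_capacity (p : R) (X : Omega -> R) (e : R) :
  PP !=set0 -> 0 < p -> Lpc PP p X -> 0 < e ->
  exists2 f : Omega -> R, continuous f &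
    (capacity PP [set w | (e <= `|X w - f w|)%R] <= e%:E)%E.
Proof.
move=> PP0 p0 [[mX _] /= aX] e0.
pose d := e `^ p * e.
have d0 : 0 < d by rewrite mulr_gt0// powR_gt0.
(* For [1 <= p] the distance is a [p]-th root, so the tolerance is the root of [d]. *)
have [|f [cf _] Xf] := aX (if 1 <= p then d `^ p^-1 else d).
  by case: ifP => // _; rewrite powR_gt0.
exists f => //; apply: capacity_le => P PPP.
have mh : measurable_fun [set: borel Omega] ((X : borel Omega -> R) \- f).
  by apply: measurable_funB => //; exact: continuous_borel_measurable.
have := @markov_powR _ _ _ P _ p e mh (ltW p0) e0.
rewrite -lee_pdivlMl ?powR_gt0// => /le_trans; apply.
rewrite lee_pdivrMl ?powR_gt0// -EFinM.
apply/ltW/(le_lt_trans _ (upper_expectation_lt_of_dist _ _ _ _ PP0 p0 d0 Xf)).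
by apply: ereal_sup_ubound; exists P.
Qed.

End capacity.

Section geometric_cauchy.
Context {R : realType}.
Variables (u : R^nat) (k : nat).
Hypothesis du : forall n, (k <= n)%N -> `|u n.+1 - u n| <= 2^-1 ^+ n.

Lemma geometric_step_dist n m : (k <= n)%N -> (n <= m)%N ->
  `|u m - u n| <= 2 * 2^-1 ^+ n.
Proof.
move=> kn /subnK <-; set j := (m - n)%N.
(* The subtracted term makes the bound the exact sum of the steps from [n] to [j + n - 1], so that
   the induction closes. *)
suff : `|u (j + n)%N - u n| <= 2 * 2^-1 ^+ n - 2 * 2^-1 ^+ (j + n).
  move=> /le_trans; apply; rewrite gerBl mulr_ge0// exprn_ge0//.
elim: j => [|j IH]; first by rewrite add0n subrr normr0 subrr.
have := du (j + n) (leq_trans kn (leq_addl _ _)).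
have := ler_distD (u (j + n)%N) (u (j.+1 + n)%N) (u n).
rewrite addSn exprS; lra.
Qed.

Lemma geometric_step_cvg : cvgn u.
Proof.
apply/cauchy_cvgP/cauchy_exP => e e0.
have [|N _ HN] := @exprVn2_lt_near R (e / 2); first by rewrite divr_gt0.
pose n := maxn k N.
exists (u n), n => // m /= nm; rewrite /ball /= distrC.
have := geometric_step_dist n m (leq_maxl _ _) nm.
have /= := HN n (leq_maxr _ _); lra.
Qed.

Lemma geometric_step_lim_dist n : (k <= n)%N ->
  `|limn u - u n| <= 2 * 2^-1 ^+ n.
Proof.
move=> kn; apply/ler_addgt0Pr => e e0.
have /cvgrPdist_le/(_ e e0)[N _ HN] := geometric_step_cvg.
have := HN (maxn n N) (leq_maxr _ _).
have := geometric_step_dist n (maxn n N) kn (leq_maxl _ _).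
have := ler_distD (u (maxn n N)) (limn u) (u n); lra.
Qed.

End geometric_cauchy.

(** The tail bound [2 * 2^-1 ^+ n] is the same at all points of [K], so convergence is uniform on
    [K] and continuity in the subspace topology passes to the limit. *)
Lemma within_continuous_geometric_lim (R : realType) (T : topologicalType)
    (f : (T -> R)^nat) (K : set T) (k : nat) :
  (forall n, continuous (f n)) ->
  (forall w n, K w -> (k <= n)%N -> `|f n.+1 w - f n w| <= 2^-1 ^+ n) ->
  {within K, continuous (fun w => limn (f ^~ w))}.
Proof.
move=> cf df.
apply: (@uniform_limit_continuous_subspace _ _ _ (f @ \oo)).
  by near_simpl; apply: nearW => n; exact: continuous_subspaceT.
move=> U /uniform_nbhs[E [+ EU]].
rewrite -entourage_from_ballE => -[e /= e0 eE].
have [|N _ HN] := @exprVn2_lt_near R (e / 2); first by rewrite divr_gt0.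
exists (maxn k N) => // n /=; rewrite geq_max => /andP[kn Nn].
apply: EU => w Kw; apply: eE => /=; rewrite /ball/=.
have := geometric_step_lim_dist (f ^~ w) k (fun n => df w n Kw) n kn.
have /= := HN n Nn; lra.
Qed.

(** Isolates what membership in [Lpc] contributes: approximation in capacity by continuous
    functions, with no exponent left. *)
Lemma has_qc_version_approx (R : realType) (Omega : completeMetricType R)
    (PP : set (probability (borel Omega) R)) (X : Omega -> R) :
  PP !=set0 -> L0 X ->
  (forall e : R, 0 < e -> exists2 f : Omega -> R, continuous f &
    (capacity PP [set w | (e <= `|X w - f w|)%R] <= e%:E)%E) ->
  has_qc_version PP X.
Proof.
move=> PP0 mX aX.
have g0 n : 0 < 2^-1 ^+ n :> R by rewrite exprn_gt0.
pose f n := projT1 (cid2 (aX _ (g0 n.+1))).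
have cf n : continuous (f n) by rewrite /f; case: cid2.
pose B n := [set w | 2^-1 ^+ n.+1 <= `|X w - f n w|].
have mB n : measurable (B n : set (borel Omega)).
  apply: (@measurable_le_normr _ _ (borel Omega)).
  by apply: measurable_funB => //; exact: continuous_borel_measurable.
have cB n : (capacity PP (B n) <= (2^-1 ^+ n.+1)%:E)%E.
  by rewrite /B /f; case: cid2.
pose U k := \bigcup_n B (n + k)%N.
have mU k : measurable (U k : set (borel Omega)) by exact: bigcup_measurable.
have cU k : (capacity PP (U k) <= (2^-1 ^+ k)%:E)%E.
  apply: capacity_bigcup_le => [n||n]; [exact: mB|exact: ltW|].
  (* The bound for [B (n + k)] is [2^-1 ^+ k] divided by [2 ^ n.+1]. *)
  by rewrite (le_trans (cB _))// natrX -exprVn -exprD addnS addnC.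
have UP k n w : (k <= n)%N -> ~ U k w -> `|X w - f n w| < 2^-1 ^+ n.+1.
  move=> kn Ukw; rewrite ltNge; apply/negP => Bnw; apply: Ukw.
  by exists (n - k)%N => //; rewrite /B /= subnK.
(* [U k] involves [X], which is only Borel, and need not be open. [G k] uses a strict inequality
   between continuous functions, hence is open. *)
pose G k := \bigcup_n
  [set w | 2^-1 ^+ (n + k) < `|f (n + k).+1 w - f (n + k)%N w|].
have GP w k n : ~ G k w -> (k <= n)%N -> `|f n.+1 w - f n w| <= 2^-1 ^+ n.
  move=> Gkw kn; rewrite leNgt; apply/negP => h; apply: Gkw.
  by exists (n - k)%N => //=; rewrite subnK.
(* Off [U k] a step is less than [2^-1 ^+ n.+1 + 2^-1 ^+ n.+2], three quarters of [2^-1 ^+ n]. *)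
have GU k : G k `<=` U k.
  move=> w [n _ /=]; apply: contraPP => Ukw; apply/negP; rewrite -leNgt.
  have := UP k (n + k)%N w (leq_addl _ _) Ukw.
  have := UP k (n + k).+1 w (leq_trans (leq_addl n k) (leqnSn _)) Ukw.
  have := ler_distD (X w) (f (n + k).+1 w) (f (n + k)%N w).
  rewrite (distrC _ (X w)) !exprS; have := g0 (n + k)%N; lra.
have g_small e : 0 < e -> exists n, 2^-1 ^+ n < e :> R.
  by move=> /exprVn2_lt_near[N _ HN]; exists N; exact: HN N (leqnn _).
have oG k : open (G k).
  by apply: bigcup_open => n _; exact: open_lt_dist.
(* Where the sequence diverges [limn] is a default value; such points lie in every [G k], hence in
   every [U k]. *)
exists (fun w => limn (f ^~ w)).
  move=> e /g_small[k ke]; exists (G k); split => //.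
  - rewrite (@le_lt_trans _ _ (2^-1 ^+ k)%:E) ?lte_fin//.
    apply: le_trans (cU k); apply: le_capacity => //.
    exact: sub_sigma_algebra.
  - by apply: (@within_continuous_geometric_lim _ _ _ _ k) => // w n Gw; exact: GP.
(* Polar, as its capacity is at most [2^-1 ^+ k] for every [k]. A point outside it misses some
   [U k], and there [f n] tends to [X]. *)
exists (\bigcap_k U k).
  split; first exact: bigcap_measurable.
  apply/eqP; rewrite eq_le capacity_ge0// andbT.
  apply/lee_addgt0Pr => e /g_small[k ke]; rewrite add0e.
  apply: (@le_trans _ _ (capacity PP (U k))).
    by apply: le_capacity => //; [exact: bigcap_measurable|exact: bigcap_inf].
  by apply: (le_trans (cU k)); rewrite lee_fin ltW.
move=> w /existsNP[k /not_implyP[_ Ukw]].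
apply/esym/cvg_lim => //; apply/cvgrPdist_lt => e /g_small[N Ne].
exists (maxn k N) => // n /=; rewrite geq_max => /andP[kn Nn].
apply: lt_trans (UP k n w kn Ukw) _; apply: le_lt_trans Ne.
by rewrite ler_wiXn2l ?invr_ge0 ?invf_le1 ?ler1n// (leq_trans Nn).
Qed.

Theorem proposition24 (R : realType) (Omega : completeMetricType R)
    (sepOmega : separable Omega)
    (PP : set (probability (borel Omega) R)) (PP0 : PP !=set0)
    (p : R) (p_gt0 : 0 < p) (X : Omega -> R) :
  Lpc PP p X -> has_qc_version PP X.
Proof.
move=> XLpc; apply: has_qc_version_approx => // [|e e0].
  by case: XLpc => -[].
exact: Lpc_approx_in_capacity p_gt0 XLpc e0.
Qed.
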